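(* Let $G=(V,w)$ be a finite metric space with diameter $\Delta(G)$, and consider input sequences of TSP with time windows and service time whose minimum laxity $L$ satisfies $L>9\Delta(G)$. Then the online algorithm ORIENT-WINDOW (described in the context) has competitive ratio $O(1)$, i.e. there is a universal constant $C$ with $\mathrm{OPT}(\sigma)\le C\cdot\mathrm{ALG}(\sigma)$ for every such sequence $\sigma$.
   Context: TSP with time windows and service time: we are given a finite metric space $G=(V,w)$ and an online sequence $\sigma$ of requests; request $i$ is a pair $([r_i,d_i],v_i)$ with $r_i,d_i$ positive integers and $v_i\in V$, revealed at time $r_i$. A single server moves in $G$; traveling from $u$ to $v$ takes $w(u,v)$ time units, and serving a request requires the server to be at the request's node for one unit of time. A request counts as served only if its service takes place within $[r_i,d_i]$. The goal is to maximize the number of served requests; $\mathrm{ALG}(\sigma)$, $\mathrm{OPT}(\sigma)$ are the numbers served by the online algorithm and by an optimal offline schedule. The minimum laxity is $L=\min_i(d_i-r_i)$; $\Delta(G)=\max_{u,v}w(u,v)$. Unrooted orienteering problem with budget $B$: given nonnegative prizes on the nodes, find a path in $G$ of total length at most $B$ (starting anywhere) maximizing the total prize of the visited nodes; a constant-factor approximation algorithm for it is used. Algorithm ORIENT-WINDOW: let $K=3\Delta(G)$. In each phase $\ell=1,2,\dots$: at time $K(\ell-1)$, replace the deadline $d$ of every unserved request by $K\lfloor d/K\rfloor$; let $R^\ell$ be the set of unserved requests released so far whose modified deadline has not passed, and let $S^\ell_j\subseteq R^\ell$ be those at node $v_j$. Run a constant-factor approximation algorithm for unrooted orienteering with budget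 $\Delta(G)$ where node $v_j$ has prize $|S^\ell_j|$, obtaining nodes $v_{i_1},\dots,v_{i_r}$ in path order. The schedule $\rho_\ell$ travels to $v_{i_1}$ and serves all of $S^\ell_{i_1}$ consecutively, then travels to $v_{i_2}$ and serves all of $S^\ell_{i_2}$, and so on. Between times $K(\ell-1)$ and $K\ell$ the requests are served according to $\rho_\ell$; whatever is not completed by time $K\ell$ is dropped from this phase.
   Formalization: The diameter is assumed to be at least 1: for diameter 0 the phases are undefined, and for diameter in (0,1) the algorithm may serve nothing while OPT ≥ 1. A modified deadline equal to the phase start counts as passed. *)

(* Defs.v *)
From HB Require Import structures.
From mathcomp Require Import all_boot all_order all_algebra.
From mathcomp Require Import boolp reals constructive_ereal.

Set Implicit Arguments.
Unset Strict Implicit.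
Unset Printing Implicit Defensive.

Import Order.TTheory GRing.Theory Num.Theory.
Local Open Scope ring_scope.

Section Metric.
Context {R : realType} {V : finType}.

Record is_metric (w : V -> V -> R) : Prop := IsMetric {
  metric_ge0 : forall u v, 0 <= w u v;
  metric_eq0 : forall u v, w u v = 0 <-> u = v;
  metric_sym : forall u v, w u v = w v u;
  metric_triangle : forall u v x, w u x <= w u v + w v x }.

Definition diameter (w : V -> V -> R) : R :=
  \big[Num.max/0]_(e : V * V) w e.1 e.2.

End Metric.

Section Orienteering.
Context {R : realType} {V : finType}.
Variable w : V -> V -> R.

Definition path_length (s : seq V) : R :=
  \sum_(e <- zip s (behead s)) w e.1 e.2.

(* A path visits each of its nodes once; the empty path is allowed. *)
Definition orienteering_path (B : R) (s : seq V) : bool :=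
  uniq s && (path_length s <= B).

Definition path_prize (p : V -> R) (s : seq V) : R := \sum_(v <- s) p v.

Definition orienteering_approx (alpha B : R) (orient : (V -> R) -> seq V) :=
  forall p : V -> R, (forall v, 0 <= p v) ->
    orienteering_path B (orient p) /\
    forall s, orienteering_path B s ->
      path_prize p s <= alpha * path_prize p (orient p).

End Orienteering.

Record request (V : Type) := Request {
  release : nat; deadline : nat; node : V }.

Section TSPTimeWindows.
Context {R : realType} {V : finType}.
Variable w : V -> V -> R.
Variables (n : nat) (sigma : n.-tuple (request V)).

Let rel (i : 'I_n) : R := (release (tnth sigma i))%:R.
Let ddl (i : 'I_n) : R := (deadline (tnth sigma i))%:R.
Let loc (i : 'I_n) : V := node (tnth sigma i).

Definition positive_times : Prop :=
  forall i, (0 < release (tnth sigma i))%N /\ (0 < deadline (tnth sigma i))%N.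

(* Extended real valued: the minimum over the empty sequence is +oo. *)
Definition min_laxity : \bar R :=
  \big[Order.min/+oo%E]_(i < n) (ddl i - rel i)%:E.

(* A service started at time t occupies [t, t + 1]. *)
Definition in_window (i : 'I_n) (t : R) : bool :=
  (rel i <= t) && (t + 1 <= ddl i).

(* A schedule lists the served requests in chronological order, each paired
   with the starting time of its service; waiting is allowed.  The server
   may be anywhere at time 0. *)
Definition feasible_schedule (s : seq ('I_n * R)) : bool :=
  [&& uniq (unzip1 s),
      all (fun x => in_window x.1 x.2) s &
      sorted (fun x y => x.2 + 1 + w (loc x.1) (loc y.1) <= y.2) s].

Definition OPT : nat :=
  \max_(S : {set 'I_n} |
      `[< exists s, feasible_schedule s /\ S = [set i in unzip1 s] >]) #|S|.

Section OrientWindow.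
Variables (orient : (V -> R) -> seq V) (v0 : V).

(* Phases are numbered from 0: phase l is the time interval
   [phase_start l, phase_start l.+1]. *)
Definition phase_length : R := 3 * diameter w.
Definition phase_start (l : nat) : R := phase_length * l%:R.

(* Rounding deadlines down is idempotent, so rounding them again in every
   phase amounts to using these rounded deadlines throughout. *)
Definition modified_deadline (i : 'I_n) : R :=
  phase_length * (Num.floor (ddl i / phase_length))%:~R.

(* The second inequality is strict: a rounded deadline equal to the start of
   the phase leaves no time and counts as passed. *)
Definition available (served : {set 'I_n}) (l : nat) : {set 'I_n} :=
  [set i | [&& i \notin served, rel i <= phase_start l &
               phase_start l < modified_deadline i]].

Definition available_at (served : {set 'I_n}) (l : nat) (v : V) : {set 'I_n} :=
  [set i in available served l | loc i == v].

Definition phase_nodes (served : {set 'I_n}) (l : nat) : seq V :=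
  orient (fun v => #|available_at served l v|%:R).

(* The server is at u at time t, then visits the nodes of vs in turn, serving
   all of S v at node v.  The requests at a node are served in the order of
   their indices; as sigma need not be sorted by release times, this
   tie-breaking order is arbitrary. *)
Fixpoint route (S : V -> {set 'I_n}) (u : V) (t : R) (vs : seq V) :
    seq ('I_n * R) :=
  if vs is v :: vs' then
    let a := t + w u v in
    zip (enum (S v)) (mkseq (fun k => a + k%:R) #|S v|)
      ++ route S v (a + #|S v|%:R) vs'
  else [::].

(* Starting times increase along a route, so the services completed by the
   end of the phase form a prefix of it. *)
Definition phase_services (served : {set 'I_n}) (u : V) (l : nat) :
    seq ('I_n * R) :=
  [seq x <- route (available_at served l) u (phase_start l)
                  (phase_nodes served l)
     | x.2 + 1 <= phase_start l.+1].

(* Requests served before phase l and position of the server at its start.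
   The server does not set out for a request whose service it could not
   complete within the phase: it stays where its last service took place. *)
Fixpoint state (l : nat) : {set 'I_n} * V :=
  if l is l'.+1 then
    let: (served, u) := state l' in
    let done := unzip1 (phase_services served u l') in
    (served :|: [set i in done], last u (map loc done))
  else (set0, v0).

Definition alg_services (l : nat) : seq ('I_n * R) :=
  phase_services (state l).1 (state l).2 l.

Definition ALG : nat :=
  #|[set i : 'I_n |
      `[< exists (l : nat) (t : R), (i, t) \in alg_services l /\ in_window i t >]]|.

End OrientWindow.

End TSPTimeWindows.

(* Main.v *)
Require Import Defs.
From HB Require Import structures.
From mathcomp Require Import all_boot all_order all_algebra.
From mathcomp Require Import boolp reals constructive_ereal.
From mathcomp Require Import lra.

(* Write D for the diameter; a phase lasts 3D.  A request which OPT starts to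
   serve in phase q can be served by the algorithm during the whole of phase
   q + 1 or of phase q - 1, because its window is longer than three phases.
   So either the algorithm has already served it before that phase l, or it
   contributes to the prizes of phase l.  The requests of the latter kind which
   OPT starts to serve within a time interval of length D lie on a path of
   length at most D and number at most D + 1.  In phase l the algorithm spends
   at most 2D on travelling, so it has time for the whole orienteering path or
   for floor D requests, hence serves at least a 1/(3 alpha) fraction of them.
   Six such intervals are charged to each phase, which gives the ratio
   1 + 18 alpha. *)

Set Implicit Arguments.
Unset Strict Implicit.
Unset Printing Implicit Defensive.

Import Order.TTheory GRing.Theory Num.Theory.
Local Open Scope ring_scope.

(** Union bound behind both charging steps: over intervals within a phase, then over phases. The
    classes [b i] may overlap. *)
Lemma count_le_sum (T : eqType) (I : finType) (p : pred T) (b : I -> pred T)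
    (s : seq T) :
  (forall x, x \in s -> p x -> exists i, b i x) ->
  (count p s <= \sum_i count (b i) s)%N.
Proof.
elim: s => [//|x s IHs] cover /=.
rewrite big_split /= leq_add //.
  case: (boolP (p x)) => // /(cover x (mem_head _ _))[i bix].
  by rewrite (bigD1 i) //= bix.
by apply: IHs => y ys; apply: cover; rewrite inE ys orbT.
Qed.

(** * Path lengths and shortcuts *)

Section PathLength.
Context {R : realType} {V : finType} (w : V -> V -> R) (w_metric : is_metric w).

Lemma le_diameter u v : w u v <= diameter w.
Proof. exact: (le_bigmax _ (fun e : V * V => w e.1 e.2) (u, v)). Qed.

Lemma path_length_nil : path_length w [::] = 0.
Proof. by rewrite /path_length big_nil. Qed.

Lemma path_length1 u : path_length w [:: u] = 0.
Proof. by rewrite /path_length /= big_nil. Qed.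

Lemma path_length_cons u v s :
  path_length w (u :: v :: s) = w u v + path_length w (v :: s).
Proof. by rewrite /path_length /= big_cons. Qed.

Lemma path_length_ge0 s : 0 <= path_length w s.
Proof. by apply: sumr_ge0 => e _; apply: metric_ge0. Qed.

Lemma path_length_behead u s : path_length w s <= path_length w (u :: s).
Proof.
case: s => [|v s]; first by rewrite path_length_nil path_length_ge0.
by rewrite path_length_cons lerDr metric_ge0.
Qed.

(* Keeping the common first node u makes the induction go through: dropping the
   node after u is a single use of the triangle inequality. *)
Lemma path_length_subseq_cons u s1 s2 :
  subseq s1 s2 -> path_length w (u :: s1) <= path_length w (u :: s2).
Proof.
elim: s2 u s1 => [|v s2 IHs] u [|x s1] //=;
  try by rewrite path_length1 path_length_ge0.
rewrite !path_length_cons; case: eqP => [-> sub|_ sub].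
  by rewrite lerD2l IHs.
have := IHs v _ sub; rewrite path_length_cons.
have := metric_triangle w_metric u v x; lra.
Qed.

Lemma path_length_subseq s1 s2 :
  subseq s1 s2 -> path_length w s1 <= path_length w s2.
Proof.
elim: s2 s1 => [|v s2 IHs] [|x s1] //=.
  by rewrite path_length_nil path_length_ge0.
case: eqP => [-> sub|_ sub]; first exact: path_length_subseq_cons.
exact: le_trans (IHs _ sub) (path_length_behead _ _).
Qed.

End PathLength.

(** * Timing of the route followed within a phase *)

Section Route.
Context {R : realType} {V : finType} (w : V -> V -> R) (w_metric : is_metric w).
Variables (n : nat) (S : V -> {set 'I_n}).

Lemma route_requests u t vs :
  unzip1 (route w S u t vs) = flatten [seq enum (S v) | v <- vs].
Proof.
elim: vs u t => [|v vs IHvs] u t //=.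
by rewrite /unzip1 map_cat -/unzip1 IHvs unzip1_zip // size_mkseq cardE.
Qed.

Lemma uniq_route u t vs :
  (forall i v1 v2, i \in S v1 -> i \in S v2 -> v1 = v2) ->
  uniq vs -> uniq (unzip1 (route w S u t vs)).
Proof.
move=> S_disjoint; rewrite route_requests.
elim: vs => [//|v vs IHvs] /= /andP[v_vs /IHvs vs_uniq].
rewrite cat_uniq enum_uniq vs_uniq andbT /=.
apply/hasPn => i /flatten_mapP[v' v'vs]; rewrite !mem_enum => iv'.
by apply: contra v_vs => iv; rewrite (S_disjoint i v v').
Qed.

Lemma size_route u t vs : size (route w S u t vs) = (\sum_(v <- vs) #|S v|)%N.
Proof.
rewrite -(size_map fst) -/(unzip1 _) route_requests size_flatten sumnE big_map.
by rewrite big_map; apply: eq_bigr => v _; rewrite cardE.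
Qed.

Lemma size_route_node v t :
  size (zip (enum (S v)) (mkseq (fun k => t + k%:R : R) #|S v|)) = #|S v|.
Proof. by rewrite size_zip size_mkseq -cardE minnn. Qed.

Lemma nth_route_time x0 u t vs k :
  (k < size (route w S u t vs))%N ->
  t <= (nth x0 (route w S u t vs) k).2 <= t + path_length w (u :: vs) + k%:R.
Proof.
elim: vs u t k => [|v vs IHvs] u t k //=.
have w0 := metric_ge0 w_metric u v.
have p0 := path_length_ge0 w_metric (v :: vs).
have k0 : 0 <= k%:R :> R by [].
rewrite size_cat nth_cat size_route_node path_length_cons.
case: (ltnP k #|S v|) => [ltk _|lek ltk].
  (* [nth_zip] expects the default value as an explicit pair. *)
  rewrite (set_nth_default (x0.1, x0.2)) ?size_route_node //.
  rewrite nth_zip ?size_mkseq -?cardE //= nth_mkseq //.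
  by apply/andP; split; lra.
rewrite -ltn_subLR // in ltk; have /andP[] := IHvs _ _ _ ltk.
have c0 : 0 <= #|S v|%:R :> R by [].
by rewrite natrB // => h1 h2; apply/andP; split; lra.
Qed.

(** For [k < m], service [k] starts after at most the whole travel and [k] unit services, so it ends
    by [e]. *)
Lemma count_route_le u t vs m (e : R) :
  t + path_length w (u :: vs) + m%:R <= e ->
  (minn (size (route w S u t vs)) m
     <= count (fun x => (x.2 + 1 <= e)%R) (route w S u t vs))%N.
Proof.
set r := route _ _ _ _ _ => le_e.
rewrite -{2}(cat_take_drop m r) count_cat (leq_trans _ (leq_addr _ _)) //.
rewrite minnC -size_take_min; apply: eq_leq; apply/esym/eqP.
(* ['I_n] may be empty, so the default for [nth] is taken from [r] itself. *)
rewrite -all_count; case E : (size r) => [|sz].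
  by move: E; case: (r).
have [x0 _] : exists x0, x0 \in r.
  by case: (r) E => // x r' _; exists x; rewrite mem_head.
apply/(all_nthP x0) => k; rewrite size_take_min leq_min => /andP[km kr].
rewrite nth_take //; have /andP[_] := nth_route_time x0 kr.
have : k%:R + 1 <= m%:R :> R by rewrite natr1 ler_nat.
by rewrite -/r; lra.
Qed.

End Route.

(** * Duration of feasible schedules *)

Section Schedule.
Context {R : realType} {V : finType} (w : V -> V -> R) (w_metric : is_metric w).
Variables (n : nat) (sigma : n.-tuple (request V)).

Let loc (i : 'I_n) : V := node (tnth sigma i).
Let follows (x y : 'I_n * R) := x.2 + 1 + w (loc x.1) (loc y.1) <= y.2.

(** Lets [sorted_filter] show that a part of a feasible schedule is still feasible. *)
Lemma follows_trans : transitive follows.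
Proof.
move=> y x z; rewrite /follows => xy yz.
have := metric_triangle w_metric (loc x.1) (loc y.1) (loc z.1); lra.
Qed.

Lemma schedule_duration x s :
  path follows x s ->
  x.2 + path_length w (map loc (unzip1 (x :: s))) + (size s)%:R
    <= (last x s).2.
Proof.
elim: s x => [|y s IHs] x /=; first by rewrite path_length1 !addr0.
case/andP=> xy /IHs /=; move: xy; rewrite /follows path_length_cons -natr1.
lra.
Qed.

(** All travel and all services but the last take place between the first and the last starting
    time; the last service accounts for the [+ 1]. *)
Lemma schedule_short a b s :
  a <= b -> sorted follows s -> all (fun x => a <= x.2 <= b) s ->
  path_length w (map loc (unzip1 s)) <= b - a /\ (size s)%:R <= b - a + 1.
Proof.
case: s => [|x s] ab /=; first by move=> *; rewrite path_length_nil; split; lra.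
move=> /schedule_duration /= dur /andP[/andP[ax xb] bs].
have lastb : (last x s).2 <= b.
  case: s dur bs => [//|y s] dur bs /=.
  by have /andP[] := allP bs _ (mem_last y s).
have := path_length_ge0 w_metric (loc x.1 :: map loc (unzip1 s)).
have : 0 <= (size s)%:R :> R by [].
by rewrite -natr1 => *; split; lra.
Qed.

End Schedule.

(** * Charging an arbitrary schedule to the phases of the algorithm *)

Section Competitive.
Context {R : realType} {V : finType} (w : V -> V -> R) (alpha : R).
Variables (orient : (V -> R) -> seq V) (v0 : V).
Variables (n : nat) (sigma : n.-tuple (request V)).
Hypotheses (alpha_ge1 : 1 <= alpha) (w_metric : is_metric w).
Hypothesis diameter_ge1 : 1 <= diameter w.
Hypothesis orient_approx : orienteering_approx w alpha (diameter w) orient.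
Hypothesis laxity : ((9 * diameter w)%:E < min_laxity (R := R) sigma)%E.

Let loc (i : 'I_n) : V := node (tnth sigma i).
Let rel (i : 'I_n) : R := (release (tnth sigma i))%:R.
Let ddl (i : 'I_n) : R := (deadline (tnth sigma i))%:R.
Let served l := (state w sigma orient v0 l).1.
Let avail l := available w sigma (served l) l.
Let services l := alg_services w sigma orient v0 l.
Let gain l := size (services l).

Lemma phase_length_gt0 : 0 < phase_length w.
Proof. by rewrite mulr_gt0 // (lt_le_trans ltr01). Qed.

Lemma phase_startS l :
  phase_start w l.+1 = phase_start w l + 3 * diameter w.
Proof. by rewrite /phase_start -[l.+1%:R]natr1 mulrDr mulr1. Qed.

Lemma phase_services_size A u l (s : seq ('I_n * R)) a b :
  sorted (fun x y => x.2 + 1 + w (loc x.1) (loc y.1) <= y.2) s ->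
  uniq (unzip1 s) ->
  {subset unzip1 s <= available w sigma A l} ->
  a <= b -> b - a <= diameter w ->
  all (fun x => a <= x.2 <= b) s ->
  (size s)%:R <= 3 * alpha * (size (phase_services w sigma orient A u l))%:R.
Proof.
move=> s_sorted s_uniq s_avail ab bad s_ab.
have [len sz] := schedule_short w_metric ab s_sorted s_ab.
pose S := available_at w sigma A l.
pose prize v : R := #|S v|%:R.
have prizeE vs : path_prize prize vs = (\sum_(v <- vs) #|S v|)%N%:R.
  by rewrite natr_sum.
have [|/andP[vs_uniq vs_len] opt] := orient_approx (p := prize); first by [].
rewrite -/(phase_nodes w sigma orient A l) in vs_uniq vs_len opt.
set vs := phase_nodes _ _ _ _ _ in vs_uniq vs_len opt.
(* [s] may return to a node, whereas an orienteering path may not; skipping the repeats does not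
   lengthen the path. *)
pose p := undup (map loc (unzip1 s)).
have p_path : orienteering_path w (diameter w) p.
  rewrite /orienteering_path undup_uniq /=.
  apply: le_trans (path_length_subseq w_metric (undup_subseq _)) _.
  exact: le_trans len bad.
have s_prize : (size s)%:R <= path_prize prize p.
  (* The route along [p] merely lists the requests counted by the prize; its start [v0] and time 0
     are arbitrary. *)
  rewrite prizeE ler_nat -(size_route w S v0 0) -(size_map fst) -(size_map fst).
  apply: uniq_leq_size => // i si; rewrite -/(unzip1 _) route_requests.
  apply/flatten_mapP; exists (loc i).
    by rewrite mem_undup map_f.
  by rewrite mem_enum /S /available_at inE s_avail ?eqxx.
have {opt} := le_trans s_prize (opt p p_path).
rewrite prizeE -(size_route w S u (phase_start w l)).
rewrite /phase_services -/vs size_filter.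
set r := route _ _ _ _ _; set g := count _ _ => s_r.
pose m := Num.truncn (diameter w).
have /andP[m_le m_gt] : m%:R <= diameter w < m.+1%:R.
  by apply: truncn_itv; lra.
have m1 : 1 <= m%:R :> R by rewrite ler1n truncn_gt0.
(* Reaching the first node and following the path cost at most one diameter each; the third is left
   for [m] services. *)
have : (minn (size r) m <= g)%N.
  apply: count_route_le => //; rewrite phase_startS.
  have vs2 : path_length w (u :: vs) <= 2 * diameter w.
    case: (vs) vs_len => [|v vs'] vs_len; first by rewrite path_length1; lra.
    rewrite path_length_cons; have := le_diameter w u v; lra.
  by lra.
have g0 : 0 <= g%:R :> R by [].
(* Either the whole path is served, or the time runs out after m services while
   size s <= diameter w + 1 <= m + 2 <= 3 m. *)
rewrite geq_min => /orP[]; rewrite -(ler_nat R) => le_g.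
  have : alpha * (size r)%:R <= alpha * g%:R.
    by rewrite ler_wpM2l ?(le_trans ler01 alpha_ge1).
  have : 0 <= alpha * g%:R by rewrite mulr_ge0 ?(le_trans ler01 alpha_ge1).
  lra.
rewrite -natr1 in m_gt.
have : g%:R <= alpha * g%:R by rewrite ler_peMl.
lra.
Qed.

Lemma phase_services_uniq A u l :
  uniq (unzip1 (phase_services w sigma orient A u l)).
Proof.
apply: subseq_uniq (map_subseq _ (filter_subseq _ _)) _.
apply: uniq_route => [i v1 v2|].
  by rewrite !inE => /andP[_ /eqP <-] /andP[_ /eqP <-].
pose prize v : R := #|available_at w sigma A l v|%:R.
by have [|/andP[]] := orient_approx (p := prize).
Qed.

Lemma phase_servicesP A u l i t :
  (i, t) \in phase_services w sigma orient A u l ->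
  [/\ i \in available w sigma A l, phase_start w l <= t
     & t + 1 <= phase_start w l.+1].
Proof.
rewrite mem_filter /= => /andP[t_le it]; split=> //.
  have : i \in unzip1 _ := map_f fst it.
  rewrite route_requests => /flatten_mapP[v _].
  by rewrite mem_enum inE => /andP[].
have /(nthP (i, t))[k k_lt itE] := it.
by have := nth_route_time w_metric (i, t) k_lt; rewrite itE => /andP[].
Qed.

(** With [K] the phase length, [K l < K floor(d / K)] iff [l + 1 <= floor(d / K)] iff
    [K (l + 1) <= d]. Hence the window of an available request contains the whole phase. *)
Lemma lt_modified_deadline l i :
  (phase_start w l < modified_deadline w sigma i)
    = (phase_start w l.+1 <= ddl i).
Proof.
have K0 := phase_length_gt0.
rewrite /phase_start /modified_deadline ltr_pM2l //.
rewrite [_ * l.+1%:R]mulrC -ler_pdivlMr //.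
by rewrite pmulrn ltr_int -lezD1 floor_ge_int -[l.+1]addn1.
Qed.

Lemma servedS l :
  served l.+1 = served l :|: [set i in unzip1 (services l)].
Proof.
by rewrite /served /services /alg_services /=; case: (state _ _ _ _ l).
Qed.

Lemma served_mono l N : (l <= N)%N -> served l \subset served N.
Proof.
elim: N => [|N IHN]; first by rewrite leqn0 => /eqP ->.
rewrite leq_eqVlt => /predU1P[-> //|/IHN].
by move/subset_trans; apply; rewrite servedS subsetUl.
Qed.

(** A phase only serves requests left over by the earlier ones, so the gains add up. *)
Lemma card_served N : #|served N| = (\sum_(l < N) gain l)%N.
Proof.
elim: N => [|N IHN]; first by rewrite big_ord0 cards0.
rewrite big_ord_recr /= -IHN servedS cardsU.
rewrite (_ : _ :&: _ = set0) ?cards0 ?subn0.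
  rewrite cardsE (card_uniqP _) ?size_map //.
  exact: phase_services_uniq.
apply/setP => i; rewrite !inE; apply/negP => /andP[iN /mapP[[j t] jt ij]].
have [] := phase_servicesP jt.
by rewrite inE -[j]ij -/(served N) iN.
Qed.

Lemma served_le_ALG N : (#|served N| <= ALG w sigma orient v0)%N.
Proof.
apply: subset_leq_card; elim: N => [|N IHN]; first exact: sub0set.
rewrite servedS subUset IHN; apply/subsetP => i.
rewrite inE => /mapP[[j t] jt ->]; rewrite inE; apply/asboolP; exists N, t.
split=> //; have [] := phase_servicesP jt.
rewrite inE lt_modified_deadline /in_window /= => /and3P[_ rj dj] ts te.
by rewrite (le_trans rj ts) (le_trans te dj).
Qed.

(** The conclusion is availability in phase [l] except for being unserved, which is settled
    separately when charging. *)
Lemma available_phase i t q :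
  in_window sigma i t -> phase_start w q <= t < phase_start w q.+1 ->
  exists2 l, q = l.-1 \/ q = l.+1 &
    rel i <= phase_start w l /\ phase_start w l < modified_deadline w sigma i.
Proof.
rewrite /in_window -/(rel i) -/(ddl i) => /andP[rt td] /andP[qt tq].
have lax : 9 * diameter w < ddl i - rel i.
  by rewrite -lte_fin; apply: lt_le_trans laxity (bigmin_le _ _ _).
have r0 : 0 <= rel i by [].
(* If phase q + 1 ends too late, the deadline falls before the end of phase
   q + 1, and the laxity puts the release before the start of phase q - 1. *)
have [dq|dq] := lerP (phase_start w q.+2) (ddl i).
  exists q.+1; first by left.
  by rewrite lt_modified_deadline; split=> //; lra.
(* Phase 0 has no predecessor, but there the deadline would be below six diameters, against the
   laxity. *)
case: q qt tq dq => [|q] qt tq dq.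
  by move: dq; rewrite !phase_startS /phase_start mulr0; lra.
exists q; first by right.
rewrite lt_modified_deadline; rewrite !phase_startS in dq qt *.
by split; lra.
Qed.

(** Phase [q] is covered by three closed intervals of one diameter, each contributing at most
    [3 * alpha * gain l]. *)
Lemma count_phase (s : seq ('I_n * R)) l q :
  feasible_schedule w sigma s ->
  (count (fun x => (x.1 \in avail l) &&
            (phase_start w q <= x.2 < phase_start w q.+1)%R) s)%:R
    <= 9 * alpha * (gain l)%:R.
Proof.
case/and3P=> s_uniq _ s_sorted.
pose a (c : 'I_3) := phase_start w q + c%:R * diameter w.
pose b c (x : 'I_n * R) :=
  (x.1 \in avail l) && (a c <= x.2 <= a c + diameter w).
apply: (@le_trans _ _ (\sum_(c < 3) (count (b c) s)%:R)).
  rewrite -natr_sum ler_nat; apply: count_le_sum => x _.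
  case/and3P=> xl; rewrite phase_startS => qx xq.
  have [x1|x1] := lerP x.2 (phase_start w q + diameter w).
    by exists (@Ordinal 3 0 isT); rewrite /b xl /a /=; apply/andP; split; lra.
  have [x2|x2] := lerP x.2 (phase_start w q + 2 * diameter w).
    by exists (@Ordinal 3 1 isT); rewrite /b xl /a /=; apply/andP; split; lra.
  by exists (@Ordinal 3 2 isT); rewrite /b xl /a /=; apply/andP; split; lra.
apply: (@le_trans _ _ (\sum_(c < 3) 3 * alpha * (gain l)%:R)); last first.
  by rewrite sumr_const card_ord; lra.
apply: ler_sum => c _; rewrite -size_filter.
apply: (@phase_services_size _ _ _ _ (a c) (a c + diameter w)).
- exact: sorted_filter (@follows_trans _ _ _ w_metric _ sigma) _ _ s_sorted.
- exact: subseq_uniq (map_subseq _ (filter_subseq _ _)) s_uniq.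
- by move=> i /mapP[x]; rewrite mem_filter => /andP[/andP[xl _] _] ->.
- by rewrite lerDl (le_trans ler01).
- by rewrite addrAC subrr add0r.
- by apply/allP => x; rewrite mem_filter => /andP[/andP[_ ]].
Qed.

Lemma schedule_size (s : seq ('I_n * R)) :
  feasible_schedule w sigma s ->
  (size s)%:R <= (1 + 18 * alpha) * (ALG w sigma orient v0)%:R.
Proof.
move=> s_feasible; have /and3P[s_uniq s_window s_sorted] := s_feasible.
have K0 := phase_length_gt0.
pose q (x : 'I_n * R) := Num.truncn (x.2 / phase_length w).
have qP x : x \in s -> phase_start w (q x) <= x.2 < phase_start w (q x).+1.
  move=> /(allP s_window)/andP[xr _].
  rewrite /phase_start mulrC -ler_pdivlMr // [_ * _.+1%:R]mulrC.
  rewrite -ltr_pdivrMr //; apply: truncn_itv.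
  by rewrite divr_ge0 ?(ltW K0) //; apply: le_trans xr.
(* A service in phase [q x] is charged to a phase at most [(q x).+1], which is thus below [N]. *)
pose N := (\max_(x <- s) q x).+2.
pose A := [pred x : 'I_n * R | x.1 \in served N].
(* For l = 0 the phase l.-1 is l itself; counting it is harmless. *)
pose b (e : 'I_N * bool) (x : 'I_n * R) := (x.1 \in avail e.1) &&
  let q := if e.2 then e.1.+1 else e.1.-1 in
  (phase_start w q <= x.2 < phase_start w q.+1).
have unserved : (count (predC A) s <= \sum_e count (b e) s)%N.
  apply: count_le_sum => x xs xA.
  have [l ql [rl ld]] := available_phase (allP s_window _ xs) (qP x xs).
  have lN : (l < N)%N.
    have : (q x <= \max_(x <- s) q x)%N by apply: leq_bigmax_seq.
    rewrite ltnS; case: ql => ->; last by move/ltnW/leqW.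
    by move=> lM; apply: leq_trans (leqSpred l) _.
  exists (Ordinal lN, q x == l.+1); rewrite /b /= inE rl ld !andbT.
  apply/andP; split.
    (* A request unserved before phase [N] was already unserved before phase [l]. *)
    by apply: contra xA; apply/subsetP/served_mono/ltnW.
  case: eqP => [<-|]; first exact: qP.
  by case: ql => [<- _|//]; apply: qP.
have served_s : (count A s <= #|served N|)%N.
  rewrite -size_filter -(size_map fst) cardE; apply: uniq_leq_size.
    exact: subseq_uniq (map_subseq _ (filter_subseq _ _)) s_uniq.
  by move=> i /mapP[x]; rewrite mem_filter mem_enum => /andP[xA _] ->.
have served_ALG : #|served N|%:R <= (ALG w sigma orient v0)%:R :> R.
  by rewrite ler_nat served_le_ALG.
(* Each phase is charged from its two neighbours, at [9 * alpha] times its gain each. *)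
have : (count (predC A) s)%:R <= 18 * alpha * #|served N|%:R.
  apply: (@le_trans _ _ (\sum_(e : 'I_N * bool) 9 * alpha * (gain e.1)%:R)).
    apply: le_trans (_ : (\sum_e count (b e) s)%:R <= _).
      by rewrite ler_nat.
    by rewrite natr_sum; apply: ler_sum => -[l d] _; apply: count_phase.
  rewrite -(pair_big xpredT xpredT
             (fun (l : 'I_N) (d : bool) => 9 * alpha * (gain l)%:R)) /=.
  rewrite card_served natr_sum mulr_sumr; apply: ler_sum => l _.
  by rewrite big_bool /=; lra.
have alpha0 : 0 <= 18 * alpha by rewrite mulr_ge0 ?(le_trans ler01 alpha_ge1).
have := ler_wpM2l alpha0 served_ALG.
move: served_s; rewrite -(ler_nat R) -(count_predC A s) natrD; lra.
Qed.

End Competitive.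

Theorem theorem5 (R : realType) (alpha : R) (alpha_ge1 : 1 <= alpha) :
  exists C : R,
  forall (V : finType) (w : V -> V -> R) (orient : (V -> R) -> seq V) (v0 : V)
         (n : nat) (sigma : n.-tuple (request V)),
    is_metric w ->
    1 <= diameter w ->
    orienteering_approx w alpha (diameter w) orient ->
    positive_times sigma ->
    ((9 * diameter w)%:E < min_laxity (R := R) sigma)%E ->
    (OPT w sigma)%:R <= C * (ALG w sigma orient v0)%:R.
Proof.
exists (1 + 18 * alpha) => V w orient v0 n sigma w_metric D1 approx _ laxity.
(* The bound passes to the maximum [OPT] from the individual schedules. *)
apply: (big_ind (fun m => m%:R <= _)) => [|m1 m2 ? ?|S /asboolP[s [s_feas ->]]].
- by rewrite mulr_ge0 // addr_ge0 // mulr_ge0 //; lra.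
- by rewrite /maxn; case: ifP.
have /and3P[s_uniq _ _] := s_feas.
rewrite cardsE (card_uniqP s_uniq) size_map.
exact: schedule_size.
Qed.
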